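(* Let $v_h\in\mathbb{V}_h$ with $v_h\ge0$ on $\partial\Omega$, and let $\Gamma(v_h)$ be its convex envelope in $B_R$. Then $$\sup_\Omega v_h^-\le C\Big(\sum_{x_i\in\mathcal{C}_h^-(v_h)}|\nabla\Gamma(v_h)(x_i)|\Big)^{1/d},$$ where $v_h^-=\max\{-v_h,0\}$, $|\nabla\Gamma(v_h)(x_i)|$ denotes the $d$-dimensional Lebesgue measure of the sub-differential of $\Gamma(v_h)$ at the contact node $x_i\in\mathcal{C}_h^-(v_h)$, and $C=C(d,\Omega)$.
   Context: $\Omega\subset\mathbb{R}^d$, $d\ge2$, is a bounded domain partitioned by a conforming mesh $\mathcal{T}_h$ of simplices; $\mathcal{N}_h$ is the set of interior nodes of $\mathcal{T}_h$; $\mathbb{V}_h$ is the space of continuous functions on $\overline\Omega$ that are affine on each $K\in\mathcal{T}_h$. Fix a ball $B_R$ of radius $R$ (depending only on $\Omega$) compactly containing $\Omega$. For $v\in C(\overline\Omega)$ with $v\ge0$ on $\partial\Omega$, extend $v^-$ by zero to $B_R\setminus\Omega$ and define the convex envelope $$\Gamma(v)(x)=\sup\{L(x):L\text{ affine},\ L\le-v^-\text{ in }B_R\},\quad x\in B_R .$$ The sub-differential of $\Gamma(v)$ at $x_0\in B_R$ is the set $\nabla\Gamma(v)(x_0)=\{w\in\mathbb{R}^d:\langle w,x-x_0\rangle+\Gamma(v)(x_0)\le\Gamma(v)(x)\ \forall x\in B_R\}$. The lower nodal contact set of $v_h\in\mathbb{V}_h$ is $\mathcal{C}_h^-(v_h)=\{z\in\mathcal{N}_h:\Gamma(v_h)(z)=v_h(z)\}$.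 *)

(* Defs.v *)
From HB Require Import structures.
From mathcomp Require Import all_boot all_order all_algebra.
From mathcomp Require Import finmap.
From mathcomp Require Import all_classical all_reals all_analysis.
Set Implicit Arguments.
Unset Strict Implicit.
Unset Printing Implicit Defensive.
Import Order.TTheory GRing.Theory Num.Theory.
Import numFieldNormedType.Exports.
Local Open Scope classical_set_scope.
Local Open Scope ring_scope.

Section euclidean.
Context {R : realType} {d : nat}.
Implicit Types (x y p : 'rV[R]_d).

Definition dotp x y : R := \sum_(i < d) x 0 i * y 0 i.

(* The library norm on ['rV[R]_d] is the sup norm; it induces the usual
   topology, but balls are taken here for the Euclidean norm. *)
Definition enorm x : R := Num.sqrt (dotp x x).

Definition eball (c : 'rV[R]_d) (r : R) : set 'rV[R]_d :=
  [set x | enorm (x - c) < r].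

Definition affine_fun (L : 'rV[R]_d -> R) : Prop :=
  exists (p : 'rV[R]_d) (b : R), forall x, L x = dotp p x + b.

Definition boundary (A : set 'rV[R]_d) : set 'rV[R]_d :=
  closure A `\` interior A.

End euclidean.

Section lebesgue.
Context {R : realType} {d : nat}.

(* A pair [b] of opposite corners encodes the open box
   [\prod_i ]b.1 0 i, b.2 0 i[]; it is empty, with volume 0, as soon as
   [b.2 0 i <= b.1 0 i] for some [i]. *)
Definition box (b : 'rV[R]_d * 'rV[R]_d) : set 'rV[R]_d :=
  [set x | forall i, b.1 0 i < x 0 i < b.2 0 i].

Definition box_volume (b : 'rV[R]_d * 'rV[R]_d) : R :=
  \prod_(i < d) Num.max (b.2 0 i - b.1 0 i) 0.

Definition box_cover (A : set 'rV[R]_d) : set (set ('rV[R]_d * 'rV[R]_d)) :=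
  [set B | countable B /\ A `<=` \bigcup_(b in B) box b].

Local Open Scope ereal_scope.

Definition lebesgue_outer (A : set 'rV[R]_d) : \bar R :=
  ereal_inf [set \esum_(b in B) (box_volume b)%:E | B in box_cover A].

Lemma box_volume_ge0 b : 0 <= (box_volume b)%:E.
Proof.
by rewrite lee_fin; apply: prodr_ge0 => i _; rewrite le_max lexx orbT.
Qed.

Lemma lebesgue_outer_ge0 A : 0 <= lebesgue_outer A.
Proof.
apply: le_ereal_inf_tmp => _ [B _ <-].
by apply: esum_ge0 => b _; exact: box_volume_ge0.
Qed.

Lemma lebesgue_outer0 : lebesgue_outer set0 = 0.
Proof.
apply/eqP; rewrite eq_le lebesgue_outer_ge0 andbT.
by apply: ereal_inf_lbound; exists set0; [split|rewrite esum_set0].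
Qed.

Lemma le_lebesgue_outer : {homo lebesgue_outer : A B / A `<=` B >-> A <= B}.
Proof.
move=> A A' AA'; apply/ereal_inf_le_tmp => _ [B [cB A'B] <-].
by exists B => //; split => //; exact: subset_trans A'B.
Qed.

Lemma lebesgue_outer_sigma_subadditive : sigma_subadditive lebesgue_outer.
Proof.
move=> A; have [[i ioo]|] := pselect (exists i, lebesgue_outer (A i) = +oo).
  rewrite (eseries_pinfty _ _ ioo) ?leey// => n _.
  by rewrite -ltNye (lt_le_trans _ (lebesgue_outer_ge0 _)).
rewrite -forallNE => Aoo.
apply/lee_addgt0Pr => _/posnumP[e].
rewrite (le_trans _ (epsilon_trick _ _ _))//; last first.
  by move=> n; exact: lebesgue_outer_ge0.
pose P n (B : set ('rV[R]_d * 'rV[R]_d)) := box_cover (A n) B /\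
  \esum_(b in B) (box_volume b)%:E
    <= lebesgue_outer (A n) + (e%:num / (2 ^ n.+1)%:R)%:E.
have [G PG] : {G : (set ('rV[R]_d * 'rV[R]_d))^nat & forall n, P n (G n)}.
  apply: (@choice _ _ P) => n; rewrite /P.
  have fA : lebesgue_outer (A n) \is a fin_num.
    by rewrite ge0_fin_numE ?lebesgue_outer_ge0// ltey; apply/eqP; exact: Aoo.
  have en1 : (0 < e%:num / (2 ^ n.+1)%:R :> R)%R by [].
  have [_ [B cB <-] /ltW leB] := lb_ereal_inf_adherent en1 fA.
  by exists B.
apply: (@le_trans _ _ (\esum_(b in \bigcup_n G n) (box_volume b)%:E)).
  apply: ereal_inf_lbound; exists (\bigcup_n G n) => //; split.
    by apply: bigcup_countable => // n _; exact: (PG n).1.1.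
  move=> x [n _ /(PG n).1.2[b Gb bx]]; exists b => //; by exists n.
rewrite seqDU_bigcup_eq esum_bigcupT; last 2 first.
- exact: trivIset_seqDU.
- by move=> b; exact: box_volume_ge0.
rewrite -nneseries_esumT; last first.
  by move=> n; apply: esum_ge0 => b _; exact: box_volume_ge0.
apply: lee_nneseries => [n ? _|n _].
  by apply: esum_ge0 => b _; exact: box_volume_ge0.
apply: le_trans (PG n).2.
apply: ge_ereal_sup => _ [X [fX XG] <-].
apply: ereal_sup_ubound; exists X => //; split => //.
by apply: subset_trans XG _; exact: subDsetl.
Qed.

HB.instance Definition _ := isOuterMeasure.Build R 'rV[R]_d lebesgue_outer
  lebesgue_outer0 lebesgue_outer_ge0 le_lebesgue_outer
  lebesgue_outer_sigma_subadditive.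

Let leb : {outer_measure set 'rV[R]_d -> \bar R} := lebesgue_outer.

(* Lebesgue measure is the restriction of the outer measure to the
   Caratheodory measurable sets. *)
Definition lebesgue_rV : {measure set (caratheodory_type leb) -> \bar R} :=
  [the measure _ _ of (leb : set (caratheodory_type leb) -> \bar R)].

End lebesgue.

Section fem.
Context {R : realType} {d : nat}.
Implicit Types (K : {fset 'rV[R]_d}) (T : {fset {fset 'rV[R]_d}}).
Implicit Types (Omega B : set 'rV[R]_d) (v : 'rV[R]_d -> R).

Definition simplex_of K : set 'rV[R]_d :=
  [set x | exists lam : 'rV[R]_d -> R,
    [/\ forall a, a \in K -> 0 <= lam a,
        \sum_(a <- K) lam a = 1 & x = \sum_(a <- K) lam a *: a]].

Definition affinely_independent K : Prop :=
  forall lam : 'rV[R]_d -> R,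
    \sum_(a <- K) lam a = 0 -> \sum_(a <- K) lam a *: a = 0 ->
    forall a, a \in K -> lam a = 0.

(* A mesh is the finite set of the vertex sets of its simplices. The common
   face [F] in [mesh_conforming] may be empty, as [simplex_of fset0] is. *)
Record conforming_mesh Omega T : Prop := ConformingMesh {
  mesh_simplex : forall K, K \in T ->
    #|` K| = d.+1 /\ affinely_independent K ;
  mesh_cover : closure Omega = \bigcup_(K in [set` T]) simplex_of K ;
  mesh_conforming : forall K K', K \in T -> K' \in T ->
    exists F : {fset 'rV[R]_d}, [/\ (F `<=` K)%fset, (F `<=` K')%fset &
      simplex_of K `&` simplex_of K' = simplex_of F] }.

Definition interior_nodes Omega T : {fset 'rV[R]_d} :=
  [fset z in (\bigcup_(K <- T) K)%fset | z \in Omega]%fset.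

(* Functions are total; only the values on [closure Omega] matter. *)
Definition fe_space Omega T : set ('rV[R]_d -> R) :=
  [set v | {within closure Omega, continuous v} /\
    forall K, K \in T -> exists2 L, affine_fun L & {in simplex_of K, v =1 L}].

(* For [x] in [B] the set is bounded above by [0], and it is nonempty when [v]
   is bounded below on [Omega], so that this [sup] is a true supremum. *)
Definition convex_envelope Omega B v (x : 'rV[R]_d) : R :=
  sup [set L x | L in [set L | affine_fun L /\
    forall y, B y -> L y <= - patch (fun=> 0) Omega v^\- y]].

Definition subdifferential B (G : 'rV[R]_d -> R) (x0 : 'rV[R]_d) :
    set 'rV[R]_d :=
  [set w | forall x, B x -> dotp w (x - x0) + G x0 <= G x].

Definition lower_contact_nodes Omega B T v : {fset 'rV[R]_d} :=
  [fset z in interior_nodes Omega T | convex_envelope Omega B v z == v z]%fset.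

End fem.

(* Main.v *)
(* Fix x0 in Omega with v x0 = - M < 0. A slope w with <w, x - x0> < M on the
   ball is a subgradient of the envelope at a contact node: v - <w, .> is
   piecewise affine, so it is minimal over the closure of Omega at a node z, and
   the choice of w forces v z < 0, hence z is interior, and makes
   x |-> v z + <w, x - z> an affine function below - v^-. All w in the cube
   [0, M / (4 r d)]^d qualify, so by subadditivity the measures of the
   subdifferentials at the contact nodes add up to at least (M / (4 r d))^d. *)
Require Import Defs.
From mathcomp Require Import all_boot all_order all_algebra.
From mathcomp Require Import finmap.
From mathcomp Require Import all_classical all_reals all_analysis.
From mathcomp Require Import measurable_realfun.
From mathcomp Require Import ring lra.
Set Implicit Arguments.
Unset Strict Implicit.
Unset Printing Implicit Defensive.
Import Order.TTheory GRing.Theory Num.Theory.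
Import numFieldNormedType.Exports.
Local Open Scope classical_set_scope.
Local Open Scope ring_scope.

(** * Lower bound for the Lebesgue outer measure of a cube *)

(** Integrate the pointwise bound over [[0, s]] and exchange sum and integral: the [k]-th interval
    contributes at most [c k] times its length. *)
Lemma weighted_itv_cover (R : realType) (s K : R) (c a b : nat -> R) :
  0 <= s -> 0 <= K -> (forall k, 0 <= c k) ->
  (forall t : R, 0 <= t <= s ->
    (K%:E <= \sum_(0 <= k <oo) (c k * (a k < t < b k)%R%:R)%:E)%E) ->
  ((K * s)%:E <= \sum_(0 <= k <oo) (c k * Num.max (b k - a k) 0)%:E)%E.
Proof.
move=> s_ge0 K_ge0 c_ge0 Kle.
pose D : set R := `[0, s]%classic; pose I k : set R := `]a k, b k[%classic.
have mD : measurable D by exact: measurable_itv.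
have mI k : measurable (I k) by exact: measurable_itv.
have indicI k t : (a k < t < b k)%R%:R = \1_(I k) t :> R.
  by rewrite indicE mem_setE in_itv.
pose g k t : \bar R := ((c k)%:E * (\1_(I k) t)%:E)%E.
have g_ge0 k t : (0 <= g k t)%E by rewrite mule_ge0// lee_fin.
have mind k : measurable_fun D (EFin \o (\1_(I k) : R -> R)).
  apply/measurable_EFinP; exact: measurable_indic.
have mg k : measurable_fun D (g k).
  exact: (measurable_funeM (c k)%:E (mind k)).
have -> : (K * s)%:E = (\int[@lebesgue_measure R]_(t in D) cst K%:E t)%E.
  rewrite integral_cst//= lebesgue_measure_itv/= lte_fin.
  case: ltgtP s_ge0 => // [_ _|<- _]; first by rewrite oppr0 adde0.
  by rewrite mulr0 mule0.
apply: (@le_trans _ _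
  (\int[@lebesgue_measure R]_(t in D) \sum_(0 <= k <oo) g k t)%E).
  apply: ge0_le_integral => //.
    exact: (@ge0_emeasurable_sum _ _ _ _ g xpredT).
  move=> t; rewrite /D /= in_itv => /Kle/le_trans; apply.
  by under eq_eseriesr => k _ do rewrite indicI EFinM.
rewrite integral_nneseries//; apply: lee_nneseries => [k _ _|k _].
  exact: integral_ge0.
rewrite ge0_integralZl//; last 2 first.
- exact: mind.
- by rewrite lee_fin.
rewrite integral_indic//; last exact: mI.
rewrite EFinM lee_wpmul2l ?lee_fin//.
apply: (@le_trans _ _ (lebesgue_measure (I k))).
  apply: le_measure; rewrite ?inE; [|exact: mI|exact: subIsetl].
  by apply: measurableI; [exact: mI|].
rewrite lebesgue_measure_itv/= lte_fin; case: ifPn => [_|_].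
  by rewrite -EFinB lee_fin le_max lexx.
by rewrite lee_fin le_max lexx orbT.
Qed.

(* The weights [c k] absorb the indicator of the last coordinate, so that the
   induction integrates one coordinate at a time. *)
Lemma weighted_box_cover (R : realType) (s K : R) (n : nat) (c : nat -> R)
    (lo hi : nat -> nat -> R) :
  0 <= s -> 0 <= K -> (forall k, 0 <= c k) ->
  (forall x : nat -> R, (forall i, 0 <= x i <= s) ->
    (K%:E <= \sum_(0 <= k <oo)
      (c k * \prod_(i < n) (lo k i < x i < hi k i)%R%:R)%:E)%E) ->
  ((K * s ^+ n)%:E <= \sum_(0 <= k <oo)
    (c k * \prod_(i < n) Num.max (hi k i - lo k i) 0)%:E)%E.
Proof.
move=> s_ge0 K_ge0; elim: n c => [|n IHn] c c_ge0 Kle.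
  rewrite expr0 mulr1; have /Kle : forall i : nat, 0 <= (fun=> 0 : R) i <= s.
    by move=> i; rewrite lexx.
  by under eq_eseriesr do rewrite big_ord0; under [in X in _ -> X]eq_eseriesr do
    rewrite big_ord0.
rewrite exprSr mulrA.
under eq_eseriesr do rewrite big_ord_recr /= mulrA.
apply: weighted_itv_cover => //; first by rewrite mulr_ge0 ?exprn_ge0.
  by move=> k; rewrite mulr_ge0// prodr_ge0// => i _; rewrite le_max lexx orbT.
(* With the last coordinate fixed at [t], its indicator joins the weight and the induction
   hypothesis handles the first [n] coordinates. *)
move=> t t0s; under eq_eseriesr do rewrite mulrAC.
apply: IHn => [k|x x0s]; first by rewrite mulr_ge0.
have /Kle : forall i : nat, 0 <= (if i == n then t else x i) <= s.
  by move=> i; case: ifP.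
congr (_ <= _)%E; apply: eq_eseriesr => k _; congr _%:E.
rewrite big_ord_recr /= eqxx mulrA mulrAC; congr (_ * _ * _).
by apply: eq_bigr => i _; rewrite ltn_eqF.
Qed.

(** The indicators of the boxes of a cover sum to at least 1 at each point of the cube, so
    [weighted_box_cover] applies with [K = 1]. *)
Lemma lebesgue_outer_cube (R : realType) (d : nat) (s : R) : 0 <= s ->
  ((s ^+ d)%:E <=
   lebesgue_outer [set w : 'rV[R]_d | forall i, (0 <= w 0 i <= s)%R])%E.
Proof.
move=> s_ge0; apply: le_ereal_inf_tmp => _ [B [/countable_injP[f finj] Bcov] <-].
(* The boxes are enumerated by [nat] through the inverse [h] of the injection [f]; indices outside
   the image of [f] get weight 0. *)
pose h := 'pinv_(fun=> 0) B f.
rewrite (reindex_esum _ _ _ _ (injpinv_bij (fun=> 0) finj)) -/h esum_mkcond.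
rewrite -nneseries_esumT; last first.
  by move=> k; case: ifP => // _; exact: box_volume_ge0.
pose lo k i := oapp (fun j : 'I_d => (h k).1 0 j) 0 (insub i).
pose hi k i := oapp (fun j : 'I_d => (h k).2 0 j) 0 (insub i).
pose c k : R := (k \in f @` B)%:R.
have -> : (\sum_(0 <= k <oo)
    (if k \in f @` B then (box_volume (h k))%:E else 0) =
  \sum_(0 <= k <oo)
    (c k * \prod_(i < d) Num.max (hi k i - lo k i) 0)%:E)%E.
  apply: eq_eseriesr => k _; rewrite /c; case: ifP => _; rewrite ?mul0r//.
  by rewrite mul1r; congr _%:E; apply: eq_bigr => i _; rewrite /hi /lo !valK.
rewrite -[s ^+ d]mul1r; apply: weighted_box_cover => // x x0s.
have /Bcov[b Bb bx] : [set w : 'rV[R]_d | forall i, 0 <= w 0 i <= s]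
    (\row_i x i) by move=> i; rewrite mxE.
have hfb : h (f b) = b by apply: pinvKV => //; rewrite inE.
(* The partial sum up to [(f b).+1] is the first to include the index [f b], whose term equals 1. *)
apply: le_trans (nneseries_lim_ge (f b).+1 _); last first.
  by move=> k _ _; rewrite lee_fin mulr_ge0// prodr_ge0.
rewrite big_nat_recr//= -[1%:E]add0e leeD//.
  by apply: sume_ge0 => k _; rewrite lee_fin mulr_ge0// prodr_ge0.
rewrite lee_fin /c mem_set; last by exists b.
rewrite mul1r big1// => i _; rewrite /lo /hi !valK /= hfb.
by have := bx i; rewrite mxE => ->.
Qed.

Lemma lebesgue_outer_bigcup_seq (R : realType) (d : nat) (I : eqType)
    (s : seq I) (F : I -> set 'rV[R]_d) (A : set 'rV[R]_d) :
  (forall w, A w -> exists2 i, i \in s & F i w) ->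
  (lebesgue_outer A <= \sum_(i <- s) lebesgue_outer (F i))%E.
Proof.
elim: s A => [|i s IHs] A AF.
  suff -> : A = set0 by rewrite big_nil lebesgue_outer0.
  by rewrite -subset0 => w /AF[].
rewrite big_cons.
have /le_lebesgue_outer/le_trans : A `<=` F i `|` (A `\` F i).
  by move=> w Aw; have [] := pselect (F i w); [left|right].
apply; apply: le_trans (outer_measureU2 _ _ _) _; rewrite leeD2l//.
apply: IHs => w [Aw nFw]; have [j] := AF w Aw.
by rewrite inE => /predU1P[->|js] Fj; [|exists j].
Qed.

Lemma exists_argmin_seq (R : realType) (I : eqType) (s : seq I) (f : I -> R) i :
  i \in s -> exists2 j, j \in s & {in s, forall k, f j <= f k}.
Proof.
elim: s i => // a s IHs _ _; case: s IHs => [_|b s IHs].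
  by exists a; rewrite ?mem_head// => k; rewrite inE => /eqP->.
have [j js jmin] := IHs b (mem_head _ _).
have [le_aj|/ltW le_ja] := leP (f a) (f j).
  exists a; rewrite ?mem_head// => k; rewrite inE => /predU1P[->//|/jmin].
  exact: le_trans.
exists j; first by rewrite inE js orbT.
by move=> k; rewrite inE => /predU1P[->//|/jmin].
Qed.

(** * Slopes on a ball and barycentric combinations *)

Section euclidean.
Context {R : realType} {d : nat}.
Implicit Types x y p w : 'rV[R]_d.

Lemma dotpDr w x y : dotp w (x + y) = dotp w x + dotp w y.
Proof.
by rewrite /dotp -big_split; apply: eq_bigr => i _; rewrite mxE mulrDr.
Qed.

Lemma dotpZr w (k : R) x : dotp w (k *: x) = k * dotp w x.
Proof.
by rewrite /dotp mulr_sumr; apply: eq_bigr => i _; rewrite mxE mulrCA.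
Qed.

Lemma dotpBr w x y : dotp w (x - y) = dotp w x - dotp w y.
Proof. by rewrite dotpDr -scaleN1r dotpZr mulN1r. Qed.

Lemma dotp_sumr w (I : Type) (s : seq I) (F : I -> 'rV[R]_d) :
  dotp w (\sum_(i <- s) F i) = \sum_(i <- s) dotp w (F i).
Proof.
elim: s => [|i s IHs]; last by rewrite !big_cons dotpDr IHs.
by rewrite !big_nil /dotp big1// => i _; rewrite mxE mulr0.
Qed.

Lemma ler_norm_enorm x i : `|x 0 i| <= enorm x.
Proof.
rewrite -sqrtr_sqr; apply: ler_wsqrtr.
rewrite /dotp (bigD1 i)//= expr2 lerDl sumr_ge0// => j _.
by rewrite -expr2 sqr_ge0.
Qed.

(** Both points are within [r] of [c] in every coordinate, so each of the [d] terms is at most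
    [s * (2 * r)]. *)
Lemma le_dotp_eball w x y (c : 'rV[R]_d) (r s : R) :
  (forall i, 0 <= w 0 i <= s) -> eball c r x -> eball c r y ->
  dotp w (x - y) <= s * (2 * r) *+ d.
Proof.
move=> w0s cx cy.
rewrite -[X in _ *+ X]card_ord -sumr_const; apply: ler_sum => i _.
have [w_ge0 ws] := andP (w0s i).
apply: (@le_trans _ _ (w 0 i * (2 * r))).
  rewrite ler_wpM2l//.
  have := le_lt_trans (ler_norm_enorm (x - c) i) cx.
  have := le_lt_trans (ler_norm_enorm (y - c) i) cy.
  rewrite !mxE !ltr_norml; lra.
rewrite ler_wpM2r//; have := le_lt_trans (sqrtr_ge0 _) cx; lra.
Qed.

Lemma affine_fun_simplex (K : {fset 'rV[R]_d}) (L : 'rV[R]_d -> R)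
    (lam : 'rV[R]_d -> R) :
  affine_fun L -> \sum_(a <- K) lam a = 1 ->
  L (\sum_(a <- K) lam a *: a) = \sum_(a <- K) lam a * L a.
Proof.
move=> [p [b Lpb]] lam1; rewrite Lpb dotp_sumr -[b]mul1r -lam1 mulr_suml.
by rewrite -big_split; apply: eq_bigr => a _; rewrite Lpb dotpZr mulrDr.
Qed.

Lemma vertex_simplex (K : {fset 'rV[R]_d}) z : z \in K -> simplex_of K z.
Proof.
move=> zK; exists (fun a => (a == z)%:R); split => //.
  rewrite (big_fsetD1 z)//= eqxx big_seq big1 ?addr0// => a.
  by rewrite !inE => /andP[/negPf->].
rewrite (big_fsetD1 z)//= eqxx scale1r big_seq big1 ?addr0// => a.
by rewrite !inE => /andP[/negPf-> _]; rewrite scale0r.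
Qed.

End euclidean.

(** * Subgradients of the envelope at contact nodes *)

Section contact.
Context {R : realType} {d : nat}.
Variables (Omega : set 'rV[R]_d) (T : {fset {fset 'rV[R]_d}}).
Variable v : 'rV[R]_d -> R.
Hypotheses (meshT : conforming_mesh Omega T) (vT : fe_space Omega T v).

Let nodes := (\bigcup_(K <- T) K)%fset.

Lemma node_closure z : z \in nodes -> closure Omega z.
Proof.
move=> /bigfcupP[K /andP[KT _] zK]; rewrite (mesh_cover meshT).
by exists K => //; exact: vertex_simplex.
Qed.

(* [v - dotp w] is affine on each simplex, so it attains its minimum over
   [closure Omega] at a node. *)
Lemma exists_node_argmin w : Omega !=set0 ->
  exists2 z, z \in nodes &
    forall x, closure Omega x -> v z - dotp w z <= v x - dotp w x.
Proof.
case=> x0 /subset_closure Ox0.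
(* The simplex containing [x0] has a vertex, because its weights sum to 1. *)
have [n nN] : exists n, n \in nodes.
  move: Ox0; rewrite (mesh_cover meshT) => -[K /= KT [lam [_ lam1 _]]].
  have [K0|[n nK]] := fset_0Vmem K.
    by move: lam1; rewrite K0 big_seq_fset0 => /esym/eqP; rewrite oner_eq0.
  by exists n; apply/bigfcupP; exists K; rewrite ?KT.
have [z zN zmin] := exists_argmin_seq (fun z => v z - dotp w z) nN.
exists z => // x; rewrite (mesh_cover meshT) => -[K /= KT Kx].
have [L Laff vL] := vT.2 K KT.
rewrite (vL x) ?inE//.
case: Kx => lam [lam_ge0 lam1 ->].
rewrite affine_fun_simplex// dotp_sumr -sumrB -[leLHS]mul1r -lam1 mulr_suml.
rewrite big_seq [leRHS]big_seq; apply: ler_sum => a aK.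
rewrite dotpZr -mulrBr ler_wpM2l ?lam_ge0//.
rewrite -vL ?inE; last exact: vertex_simplex.
by apply: zmin; apply/bigfcupP; exists K; rewrite ?KT.
Qed.

(* The affine function of slope [w] touching [v] from below at the minimizing
   node is nonpositive on [B], hence admissible in the convex envelope. *)
Lemma exists_contact_subdifferential (B : set 'rV[R]_d) w x0 :
  open Omega -> closure Omega `<=` B ->
  (forall x, boundary Omega x -> 0 <= v x) ->
  Omega x0 -> (forall x, B x -> dotp w (x - x0) < - v x0) ->
  exists2 z, z \in lower_contact_nodes Omega B T v &
    subdifferential B (convex_envelope Omega B v) z w.
Proof.
move=> Oopen OB v_ge0 Ox0 wv.
have [z zN zmin] := exists_node_argmin w (ex_intro _ _ Ox0).
have Oz := node_closure zN.
have zx0 := zmin _ (subset_closure Ox0).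
(* Minimality against [x0] gives [v z <= v x0 + dotp w (z - x0)], which is negative by [wv]. *)
have vz_lt0 : v z < 0.
  by have := wv _ (OB _ Oz); rewrite dotpBr; lra.
have {}Oz : Omega z.
  apply: contrapT => nOz; suff /v_ge0 : boundary Omega z by lra.
  by split => // /interior_subset.
pose L x := dotp w x + (v z - dotp w z).
pose E x := [set L x | L in [set L | affine_fun L /\
  forall y, B y -> L y <= - patch (fun=> 0) Omega v^\- y]].
have Lv : affine_fun L /\
    forall y, B y -> L y <= - patch (fun=> 0) Omega v^\- y.
  split; first by exists w, (v z - dotp w z).
  move=> y By; rewrite /patch /L.
  (* Minimality also gives [L x0 <= v x0], so [L y <= v x0 + dotp w (y - x0) < 0]. This settles the
     points outside [Omega]; inside, [L <= v] is needed as well. *)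
  have L_le0 : dotp w y + (v z - dotp w z) <= 0.
    by have := wv _ By; rewrite dotpBr; lra.
  case: ifPn => [|_]; last by rewrite oppr0.
  rewrite inE /funrneg => /subset_closure/zmin zy.
  by rewrite maxEle; case: ifP => _; lra.
have Eub x : B x -> ubound (E x) (- patch (fun=> 0) Omega v^\- x).
  by move=> Bx _ [L' [_ L'v] <-]; exact: L'v.
have LGamma x : B x -> L x <= convex_envelope Omega B v x.
  move=> Bx; apply: ub_le_sup; last by exists L.
  by exists (- patch (fun=> 0) Omega v^\- x); exact: Eub.
have Bz : B z by apply/OB/subset_closure.
have Gz : convex_envelope Omega B v z = v z.
  apply/eqP; rewrite eq_le; apply/andP; split; last first.
    by have := LGamma z Bz; rewrite /L; lra.
  (* Since [v z < 0], the upper bound imposed on the admissible functions at [z] is [v z] itself,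
     and [L] attains it. *)
  have -> : v z = - patch (fun=> 0) Omega v^\- z.
    by rewrite /patch mem_set// /funrneg maxEle; case: ifP; lra.
  by apply: ge_sup (Eub _ Bz); exists (L z), L.
exists z; first by rewrite !inE/= zN mem_set//= Gz eqxx.
by move=> x /LGamma; rewrite Gz dotpBr /L; lra.
Qed.

End contact.

Theorem proposition5p1 (R : realType) (d : nat) (Omega : set 'rV[R]_d)
    (c : 'rV[R]_d) (r : R)
    (d_ge2 : (2 <= d)%N)
    (Omega_neq0 : Omega !=set0) (Omega_open : open Omega)
    (Omega_connected : connected Omega) (Omega_bounded : bounded_set Omega)
    (Omega_ball : closure Omega `<=` eball c r) :
  exists2 C : R, 0 < C &
    forall (T : {fset {fset 'rV[R]_d}}) (v : 'rV[R]_d -> R),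
      conforming_mesh Omega T ->
      fe_space Omega T v ->
      (forall x, boundary Omega x -> 0 <= v x) ->
      let Gamma := convex_envelope Omega (eball c r) v in
      (ereal_sup [set (v^\- x)%:E | x in Omega] <=
       C%:E * (\sum_(z <- lower_contact_nodes Omega (eball c r) T v)
                 lebesgue_rV (subdifferential (eball c r) Gamma z))
              `^ (d%:R^-1))%E.
Proof.
have r_gt0 : 0 < r.
  have [x /subset_closure/Omega_ball] := Omega_neq0.
  exact: le_lt_trans (sqrtr_ge0 _).
have d_gt0 : 0 < d%:R :> R by rewrite ltr0n (leq_trans _ d_ge2).
have C_gt0 : 0 < 4 * r * d%:R by rewrite !mulr_gt0.
(* For slopes in the cube of side [s = - v x0 / (4 * r * d)], [le_dotp_eball] gives [- v x0 / 2];
   the spare factor 2 makes the bound strict. *)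
exists (4 * r * d%:R) => // T v meshT vT v_ge0; cbv zeta.
set Gamma := convex_envelope _ _ _.
pose S := (\sum_(z <- lower_contact_nodes Omega (eball c r) T v)
  lebesgue_outer (subdifferential (eball c r) Gamma z))%E.
(* [lebesgue_rV] is by definition [lebesgue_outer] on every set, so the two sums are convertible. *)
rewrite -[X in (X `^ _)%E]/S.
apply: ge_ereal_sup => _ [x0 Ox0 <-].
rewrite /funrneg maxEle; case: ifPn => [_|].
  by rewrite mule_ge0 ?poweR_ge0// lee_fin ltW.
rewrite -ltNge oppr_gt0 => vx0.
pose s := - v x0 / (4 * r * d%:R).
have s_gt0 : 0 < s by rewrite divr_gt0 ?oppr_gt0.
have leS : ((s ^+ d)%:E <= S)%E.
  apply: le_trans (lebesgue_outer_cube d (ltW s_gt0)) _.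
  apply: lebesgue_outer_bigcup_seq => w w0s.
  apply: (exists_contact_subdifferential meshT vT _ _ _ Ox0) => // x Bx.
  have Bx0 := Omega_ball _ (subset_closure Ox0).
  apply: le_lt_trans (le_dotp_eball w0s Bx Bx0) _.
  rewrite -mulr_natr.
  have -> : s * (2 * r) * d%:R = - v x0 / 2.
    by rewrite /s; field; rewrite !gt_eqF.
  lra.
have S_ge0 : (0 <= S)%E by apply: le_trans leS; rewrite lee_fin exprn_ge0 ?ltW.
(* Writing [s] as the [d]-th root of [s ^+ d] reduces the goal to [leS] and monotonicity of the
   root. *)
have -> : (- v x0)%:E = ((4 * r * d%:R)%:E * (s ^+ d)%:E `^ d%:R^-1)%E.
  rewrite poweR_EFin -powR_mulrn ?ltW// -powRrM divff ?gt_eqF// powRr1 ?ltW//.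
  by rewrite -EFinM /s mulrC divfK ?gt_eqF.
apply: lee_wpmul2l; first by rewrite lee_fin ltW.
apply: (gt0_ler_poweR _ _ _ leS).
- by rewrite invr_ge0 ltW.
- by rewrite in_itv/= leey andbT lee_fin exprn_ge0// ltW.
- by rewrite in_itv/= S_ge0 leey.
Qed.
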